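(* Let $R$ be a commutative ring with unity and $t$ a positive integer. Suppose that every ideal of $R$ of the form $(0:b)$ for some $0\neq b\in R$ is semiprime. The following statements are equivalent: 1. every $R$-module is $\varepsilon^{t}$-reduced; 2. every cyclic $R$-module is $\varepsilon^{t}$-reduced; 3. $R$ is $t$-regular.
   Context: For $b\in R$, $(0:b):=\{r\in R\mid rb=0\}$. An ideal $J$ of $R$ is semiprime if for all $a\in R$, $a^{2}\in J$ implies $a\in J$. An $R$-module $M$ is $\varepsilon^{t}$-reduced if for all $a\in R$, all $m\in M$ and all positive integers $k\geq t$, $a^{k}m=0$ implies $a^{t}m=0$. The ring $R$ is $t$-regular if for every $a\in R$ there exists $b\in R$ such that $a^{t}=a^{2t}b$. *)

(* Defs.v *)
From mathcomp Require Import all_boot all_algebra.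
From mathcomp Require Import classical_sets.

Set Implicit Arguments.
Unset Strict Implicit.
Unset Printing Implicit Defensive.

Import GRing.Theory.
Local Open Scope ring_scope.
Local Open Scope classical_set_scope.

(* Ideals are Prop-valued sets, and need not be proper: the library's
   [idealr_closed] is a boolean predicate that excludes the unit ideal. *)
Definition is_ideal (R : comPzRingType) (J : set R) : Prop :=
  [/\ J 0,
      forall x y, J x -> J y -> J (x + y) &
      forall r x, J x -> J (r * x)].

Definition colon0 (R : comPzRingType) (b : R) : set R :=
  [set r : R | r * b = 0].

Definition semiprime (R : comPzRingType) (J : set R) : Prop :=
  is_ideal J /\ (forall a : R, J (a ^+ 2) -> J a).

Definition eps_reduced (R : comPzRingType) (t : nat) (M : lmodType R) : Prop :=
  forall (a : R) (m : M) (k : nat), (0 < k)%N -> (t <= k)%N ->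
    a ^+ k *: m = 0 -> a ^+ t *: m = 0.

Definition cyclic_module (R : comPzRingType) (M : lmodType R) : Prop :=
  exists m : M, forall x : M, exists r : R, x = r *: m.

Definition regular_ring (R : comPzRingType) (t : nat) : Prop :=
  forall a : R, exists b : R, a ^+ t = a ^+ (2 * t)%N * b.

(* Main.v *)
Require Import Defs.
From HB Require Import structures.
From mathcomp Require Import all_boot all_algebra.
From mathcomp Require Import boolp classical_sets.

Import GRing.Theory.
Local Open Scope ring_scope.

(** If [R] is [t]-regular, substituting [a ^+ t = a ^+ (2 * t) * b] into itself
    shows that [a ^+ t] is a multiple of every power of [a]; so any vector killed
    by some power of [a] is killed by [a ^+ t], in every module.

    Conversely, the cyclic module [R / (a ^+ (2 * t))] has a generator killed by
    [a ^+ (2 * t)]. If the module is [eps_reduced t], its generator is killed by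
    [a ^+ t], which says that [a ^+ t] lies in the ideal [(a ^+ (2 * t))]; this is
    [t]-regularity at [a]. *)

Section IdealQuotient.
Variables (R : comPzRingType) (J : set R) (idealJ : is_ideal J).

(** Membership in [J] is turned into a boolean, as [Quotient.quot]
    requires. *)
Let boolJ : {pred R} := fun r => `[< J r >].

Fact boolJ_zmod_closed : zmod_closed boolJ.
Proof.
have [J0 JD JM] := idealJ.
split=> [|x y /asboolP Jx /asboolP Jy]; apply/asboolP => //.
by apply: JD => //; rewrite -mulN1r; apply: JM.
Qed.

Definition ideal_zmod : zmodClosed R :=
  HB.pack boolJ (GRing.isZmodClosed.Build R boolJ boolJ_zmod_closed).

Definition ideal_quotient : Type := Quotient.quot ideal_zmod.

HB.instance Definition _ := GRing.Zmodule.on ideal_quotient.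

Definition ideal_proj (r : R) : ideal_quotient :=
  \pi_(Quotient.quot ideal_zmod)%qT r.

Lemma ideal_proj_eq x y : ideal_proj x = ideal_proj y <-> J (x - y).
Proof.
split=> [/eqP|Jxy]; last apply/eqP; rewrite /ideal_proj -Quotient.idealrBE.
  by move/asboolP.
exact/asboolP.
Qed.

Lemma ideal_projD : {morph ideal_proj : x y / x + y}.
Proof. exact: Quotient.pi_add. Qed.

Lemma ideal_proj_repr (x : ideal_quotient) :
  ideal_proj (generic_quotient.repr x) = x.
Proof. exact: generic_quotient.reprK. Qed.

Definition ideal_quotient_scale (r : R) (x : ideal_quotient) : ideal_quotient :=
  ideal_proj (r * generic_quotient.repr x).

Lemma ideal_quotient_scale_proj r x :
  ideal_quotient_scale r (ideal_proj x) = ideal_proj (r * x).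
Proof.
have [_ _ JM] := idealJ; apply/ideal_proj_eq; rewrite -mulrBr; apply: JM.
exact/ideal_proj_eq/ideal_proj_repr.
Qed.

Fact ideal_quotient_scalerA a b x :
  ideal_quotient_scale a (ideal_quotient_scale b x) =
  ideal_quotient_scale (a * b) x.
Proof.
by rewrite -[x]ideal_proj_repr !ideal_quotient_scale_proj mulrA.
Qed.

Fact ideal_quotient_scale1r : left_id 1 ideal_quotient_scale.
Proof.
by move=> x; rewrite -[x]ideal_proj_repr ideal_quotient_scale_proj mul1r.
Qed.

Fact ideal_quotient_scalerDr : right_distributive ideal_quotient_scale +%R.
Proof.
move=> a x y; rewrite -[x]ideal_proj_repr -[y]ideal_proj_repr.
by rewrite -ideal_projD !ideal_quotient_scale_proj mulrDr ideal_projD.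
Qed.

Fact ideal_quotient_scalerDl x : {morph ideal_quotient_scale^~ x : a b / a + b}.
Proof.
move=> a b; rewrite -[x]ideal_proj_repr.
by rewrite !ideal_quotient_scale_proj mulrDl ideal_projD.
Qed.

HB.instance Definition _ := GRing.Zmodule_isLmodule.Build R ideal_quotient
  ideal_quotient_scalerA ideal_quotient_scale1r
  ideal_quotient_scalerDr ideal_quotient_scalerDl.

Lemma scale_ideal_proj1 r : r *: ideal_proj 1 = ideal_proj r.
Proof. by rewrite [LHS]ideal_quotient_scale_proj mulr1. Qed.

Lemma cyclic_ideal_quotient : cyclic_module ideal_quotient.
Proof.
exists (ideal_proj 1) => x; exists (generic_quotient.repr x).
by rewrite scale_ideal_proj1 ideal_proj_repr.
Qed.

(** The annihilator of the generator of [R / J] is [J]: this turns a statement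
    about modules into membership in an ideal. *)
Lemma scale_ideal_proj1_eq0 r : r *: ideal_proj 1 = 0 <-> J r.
Proof.
have <- : ideal_proj 0 = 0 by rewrite -scale_ideal_proj1 scale0r.
by rewrite scale_ideal_proj1 -[in J r](subr0 r); apply: ideal_proj_eq.
Qed.

End IdealQuotient.

Definition principal_ideal (R : comPzRingType) (c : R) : set R :=
  [set r | exists b, r = c * b]%classic.

Lemma principal_is_ideal (R : comPzRingType) (c : R) :
  is_ideal (principal_ideal R c).
Proof.
split=> [|_ _ [x ->] [y ->]|r _ [x ->]]; first by exists 0; rewrite mulr0.
  by exists (x + y); rewrite mulrDr.
by exists (r * x); rewrite mulrCA.
Qed.

(** Each substitution of the regularity relation into itself gains a factor
    [a ^+ t]. *)
Lemma regular_expr_multiple (R : comPzRingType) (t : nat) (a b : R) n :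
  a ^+ t = a ^+ (2 * t)%N * b -> a ^+ t = a ^+ (t * n.+1)%N * b ^+ n.
Proof.
move=> abE; elim: n => [|n IHn]; first by rewrite muln1 mulr1.
rewrite {1}IHn mulnS exprD {1}abE (mulrAC _ b) -(mulrA _ b) -exprS -exprD.
by rewrite mul2n -addnn -addnA -!mulnS.
Qed.

Lemma regular_eps_reduced (R : comPzRingType) (t : nat) (M : lmodType R) :
  (0 < t)%N -> regular_ring R t -> eps_reduced t M.
Proof.
move=> t_gt0 regR a m k _ _ akm0;
have [b /(regular_expr_multiple _ _ _ _ k) ->] := regR a.
have le_k : (k <= t * k.+1)%N by rewrite (leq_trans (leqnSn k)) ?leq_pmull.
by rewrite -(subnK le_k) exprD mulrAC -scalerA akm0 scaler0.
Qed.

Lemma cyclic_eps_reduced_regular (R : comPzRingType) (t : nat) :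
    (0 < t)%N ->
    (forall M : lmodType R, cyclic_module M -> eps_reduced t M) ->
  regular_ring R t.
Proof.
move=> t_gt0 redR a; set idealJ := principal_is_ideal R (a ^+ (2 * t)).
apply/(scale_ideal_proj1_eq0 R _ idealJ).
apply: (redR _ (cyclic_ideal_quotient R _ idealJ) a _ (2 * t)%N).
- by rewrite muln_gt0.
- by rewrite leq_pmull.
- by apply/scale_ideal_proj1_eq0; exists 1; rewrite mulr1.
Qed.

Theorem theorem3p9 (R : comPzRingType) (t : nat) (ht : (0 < t)%N)
    (hR : forall b : R, b <> 0 -> semiprime (colon0 b)) :
  ((forall M : lmodType R, eps_reduced t M) <->
   (forall M : lmodType R, cyclic_module M -> eps_reduced t M)) /\
  ((forall M : lmodType R, cyclic_module M -> eps_reduced t M) <->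
   regular_ring R t).
Proof.
have regR := cyclic_eps_reduced_regular R t ht.
have redR M := regular_eps_reduced R t M ht.
split; split; auto.
Qed.
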